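(* (a) Let $(X,\mu)$ be a branching random walk with generating function $G$. For every subset $A \subseteq X$ and every fixed point $\mathbf{z}\in[0,1]^X$ of $G$, the following assertions are equivalent: (1) $\mathbf{q}(x,A) \le \mathbf{z}(x)$ for all $x \in X$; (2) $\mathbf{q}_0(x,A) \le \mathbf{z}(x)$ for all $x \in X$. In particular, if $\mathbf{z} = \mathbf{q}(\cdot,B)$ where $A \subseteq B\subseteq X$, then the previous conditions are equivalent to (3) $\mathbf{q}(x,A) = \mathbf{q}(x,B)$ for all $x \in X$. (b) Consider two branching random walks $(X,\mu)$ and $(X,\nu)$ on the same set $X$, and denote their extinction probabilities by $\mathbf{q}^\mu,\mathbf{q}^\mu_0$ and $\mathbf{q}^\nu,\mathbf{q}^\nu_0$ respectively. Suppose that $A \subseteq X$ is a nonempty set such that $\mu_x = \nu_x$ for all $x \notin A$. Then $\mathbf{q}^\mu_0(\cdot,A) = \mathbf{q}^\nu_0(\cdot,A)$. Moreover, if $A \subseteq B\subseteq X$, then $$\mathbf{q}^\mu(x,A) = \mathbf{q}^\mu(x,B)\ \ \forall x \in X \iff \mathbf{q}^\nu(x,A) = \mathbf{q}^\nu(x,B)\ \ \forall x \in X.$$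
   Context: Branching random walk (BRW). Let $X$ be an at most countable set, $\mathbb{N}=\{0,1,2,\dots\}$, $S_X := \{f : X \to \mathbb{N} : \sum_{y} f(y) < \infty\}$ (a countable set, with the $\sigma$-algebra $2^{S_X}$), and let $\mu = \{\mu_x\}_{x \in X}$ be a family of probability measures on $S_X$. The (discrete-time) BRW $(X,\mu)$ is the Markov chain $\{\eta_n\}_{n \in \mathbb{N}}$, where $\eta_n(x)$ is the number of particles alive at $x$ at time $n$, with the following dynamics: each particle of generation $n$ at a site $x$ lives one unit of time, after which a function $f \in S_X$ is chosen at random according to $\mu_x$ and the particle is replaced by $f(y)$ particles at $y$, for all $y \in X$; the choices are independent for all particles. $\mathbb{P}^{\delta_x}$ is the law of the process started from one particle at $x$. Generating function. $G : [0,1]^X \to [0,1]^X$ is defined by $G(\mathbf{z}|x) := \sum_{f \in S_X} \mu_x(f) \prod_{y \in X} \mathbf{z}(y)^{f(y)}$, where $G(\mathbf{z}|x)$ is the $x$-coordinate of $G(\mathbf{z})$. A fixed point is $\mathbf{z}$ with $G(\mathbf{z}) = \mathbf{z}$. Extinction probabilities. For $A \subseteq X$, $x\in X$, $n\in\mathbb{N}$, $\mathbf{q}_n(x,A) := \mathbb{P}^{\delta_x}(\eta_k(y) = 0\ \forall k \ge n,\ \forall y \in A)$ (so $\mathbf{q}_0(x,A)$ is the probability that $A$ is never visited, including at time $0$), and $\mathbf{q}(x,A) := 1 - \mathbb{P}^{\delta_x}\big(\limsup_{n \to \infty} \sum_{y \in A} \eta_n(y) > 0\big)$ is the probability of extinction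 in $A$. Each vector $\mathbf{q}(\cdot,A)$ is a fixed point of $G$. *)

(* Defs.v *)
From HB Require Import structures.
From mathcomp Require Import all_boot all_order all_algebra.
From mathcomp Require Import finmap.
From mathcomp Require Import all_classical all_reals all_analysis.

Set Implicit Arguments.
Unset Strict Implicit.
Unset Printing Implicit Defensive.

Import Order.TTheory GRing.Theory Num.Theory.

Local Open Scope classical_set_scope.
Local Open Scope ring_scope.

(** The space S_X of particle configurations: an [nat]-valued function on a
    countable set has finite sum iff it has finite support. *)
Definition config (X : countType) : Type := {fsfun X -> nat with 0%N}.

Definition fun_of_config (X : countType) (f : config X) : X -> nat :=
  @fun_of_fsfun X nat (fun=> 0%N) f.
Coercion fun_of_config : config >-> Funclass.

HB.instance Definition _ (X : countType) :=
  Countable.copy (config X) {fsfun X -> nat with 0%N}.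
HB.instance Definition _ (X : countType) :=
  isPointed.Build (config X) [fsfun for fun=> 0%N].
HB.instance Definition _ (X : countType) :=
  @isMeasurable.Build default_measure_display (config X)
    discrete_measurable discrete_measurable0
    discrete_measurableC discrete_measurableU.

Definition supp (X : countType) (f : config X) : {fset X} :=
  @finsupp X nat (fun=> 0%N) f.

Definition one_particle (X : countType) (x : X) : config X :=
  [fsfun y in [fset x]%fset => 1%N | 0%N].

(** The individual particles of [f]: [Tagged _ i] at site [y] is the [i]-th of
    the [f y] particles located at [y]. *)
Definition particle (X : countType) (f : config X) : finType :=
  {y : supp f & 'I_(f (val y))}.

Definition site (X : countType) (f : config X) (k : particle f) : X :=
  val (tag k).

Section BranchingRandomWalk.
Variables (R : realType) (X : countType).
Implicit Types (mu : X -> probability (config X) R) (f g : config X).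

(** Probability of going from [f] to [g] in one generation: the sum, over all
    assignments [h] of an offspring configuration to each particle of [f] whose
    total is [g], of the probability of [h] when the particles reproduce
    independently, a particle at [y] according to [mu y]. *)
Definition brw_transition mu f g : \bar R :=
  \esum_(h in [set h : {ffun particle f -> config X} |
                forall y, (\sum_(k : particle f) h k y)%N = g y])
    (\prod_(k : particle f) mu (site k) [set h k])%E.

(** [is_brw mu P eta]: under each [P x], the process [eta] is a Markov chain
    started from one particle at [x], with transition probabilities
    [brw_transition mu].  The Markov property is stated in product form, which
    avoids conditioning on null events. *)
Record is_brw mu d (T : measurableType d) (P : X -> probability T R)
    (eta : nat -> T -> config X) : Prop := IsBrw {
  brw_measurable : forall n, measurable_fun [set: T] (eta n) ;
  brw_start : forall x, P x [set w | eta 0%N w = one_particle x] = 1%E ;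
  brw_markov : forall x n (s : nat -> config X),
    P x [set w | forall k, (k <= n.+1)%N -> eta k w = s k] =
    (P x [set w | forall k, (k <= n)%N -> eta k w = s k]
     * brw_transition mu (s n) (s n.+1))%E }.

(** The generating function; it is only meant for [z] with values in [0, 1],
    where the series converges and [fine] loses nothing. *)
Definition genfun mu (z : X -> R) (x : X) : R :=
  fine (\esum_(f in [set: config X])
    (mu x [set f] * (\prod_(y <- supp f) z y ^+ f y)%:E)%E).

Definition fixed_point mu (z : X -> R) : Prop :=
  (forall x, 0 <= z x <= 1) /\ (forall x, genfun mu z x = z x).

Section Extinction.
Context d (T : measurableType d).
Variables (P : X -> probability T R) (eta : nat -> T -> config X).

Definition q_ (n : nat) (A : set X) (x : X) : R :=
  fine (P x [set w | forall k, (n <= k)%N -> forall y, A y -> eta k w y = 0%N]).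

Definition q (A : set X) (x : X) : R :=
  1 - fine (P x [set w |
    (0 < limn_esup (fun n => \esum_(y in A) ((eta n w y)%:R : R)%:E))%E]).

End Extinction.
End BranchingRandomWalk.

(* Main.v *)
Require Import Defs.
From mathcomp Require Import all_boot all_order all_algebra.
From mathcomp Require Import finmap.
From mathcomp Require Import all_classical all_reals all_analysis.

Set Implicit Arguments.
Unset Strict Implicit.
Unset Printing Implicit Defensive.

Import Order.TTheory GRing.Theory Num.Theory.
Import numFieldNormedType.Exports.

Local Open Scope classical_set_scope.
Local Open Scope ring_scope.

(** Two ideas carry the proof.

    The first is that everything is computed by the generating function G.
    Writing z^f for the product of the z(y)^f(y), the branching property says
    that one generation acts on such products by replacing z with G(z):
    the sum over g of p(f, g) z^g is (G z)^f [transition_monom].  Let C be a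
    sequence of sets and ask that the process have no particle in C(k) at time
    k, for every k at most N.  The indicator that f avoids C(0) is z^f for z
    the indicator of the complement of C(0), hence, by the Markov property,
    the probability of avoidance is obtained by alternately applying G and
    multiplying by indicators [path_avoid, avoid_iterE].  Letting N tend to
    infinity, and using that G is continuous for pointwise convergence in
    [0, 1], the probability W(C) of avoiding C for ever satisfies
    W(C) = G(W(shift of C)) as soon as C(0) is empty [avoid_probS].

    For the sets that are empty before time n and equal to A afterwards this
    reads q_(n+1) = G(q_n).  As q_n increases to q, the vector q(., A) is a
    fixed point; and if z is a fixed point with q_0 <= z, then q_n <= z for
    all n because G is monotone, so that q <= z [q_le_fixed].  This is (a).

    The second idea is for (b): the equality of q(., A) and q(., B) has to be
    expressed through the behaviour of the process before it visits A, which
    does not depend on the laws at the sites of A.  The right quantity is the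
    probability r(x) of never visiting A and visiting B only finitely often.
    If q(., A) = q(., B), then the two extinction events agree up to a null
    set, so r = q_0(., A); conversely, r = q_0(., A) gives
    q_0(., A) <= q(., B), which implies the equality by (a)
    [q_eq_switch].  Now r is the limit of the probabilities of avoiding A
    before time n and B from time n on; in the iteration computing these, the
    value of G at a site of A is always multiplied by 0, so only the laws
    off A matter [eq_avoid_iter, eq_avoid_prob]. *)

(** * Countable sums *)

Section Preliminaries.
Variable R : realType.

Lemma esumZl (T : choiceType) (D : set T) (r : R) (a : T -> \bar R) :
  0 <= r -> (forall i, (0 <= a i)%E) ->
  (\esum_(i in D) (r%:E * a i) = r%:E * \esum_(i in D) a i)%E.
Proof.
move=> r0 a0; rewrite /esum -ereal_supZl//; last first.
  apply/set0P; exists (\sum_(i \in set0) a i)%E.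
  by exists set0 => //; exact: fsets_set0.
congr ereal_sup; apply/seteqP; split => t /=.
- move=> [F [finF FD] <-]; exists (\sum_(i \in F) a i)%E; first by exists F.
  by rewrite ge0_mule_fsumr.
- move=> [x [F [finF FD] <-] <-]; exists F => //.
  by rewrite ge0_mule_fsumr.
Qed.

Lemma esum_countType (C : countType) (a : C -> \bar R) :
  (forall c, 0 <= a c)%E ->
  (\esum_(c in [set: C]) a c =
   \sum_(0 <= i <oo) oapp a 0 (@pickle_inv C i : option C))%E.
Proof.
move=> a0; rewrite nneseries_esumT; last by move=> i; case: pickle_inv => //=.
transitivity (\esum_(i in (@choice.pickle C) @` setT)
    oapp a 0 (@pickle_inv C i : option C))%E.
  rewrite (esum_image setT (@choice.pickle C)); last first.
    by move=> x y _ _; exact: (pcan_inj (@choice.pickleK C)).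
  by apply: eq_esum => c _; rewrite pickleK_inv.
rewrite esum_mkcond; apply: eq_esum => i _; case: ifPn => // /negP Hi.
case E: (@pickle_inv C i) => [c|]//=; exfalso; apply: Hi; rewrite inE.
by exists c => //; have := @pickle_invK C i; rewrite E /=.
Qed.

(** Dominated convergence, transported from the counting measure on the natural
    numbers along an encoding of the countable index type. *)
Lemma cvg_esum (C : countType) (a : nat -> C -> R) (b g : C -> R) :
  (forall c, a n c @[n --> \oo] --> b c) ->
  (forall n c, 0 <= a n c <= g c) ->
  (\esum_(c in [set: C]) (g c)%:E < +oo)%E ->
  (\esum_(c in [set: C]) (a n c)%:E)%E @[n --> \oo]
    --> (\esum_(c in [set: C]) (b c)%:E)%E.
Proof.
move=> ab ag goo.
have g0 c : 0 <= g c by have /andP[/le_trans h /h] := ag 0 c.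
have b0 c : 0 <= b c.
  rewrite -(cvg_lim (@Rhausdorff R) (ab c)).
  apply: limr_ge; first by apply/cvg_ex; exists (b c).
  by apply: nearW => n; case/andP: (ag n c).
pose F (h : C -> R) i := oapp (EFin \o h) 0%E (@pickle_inv C i).
have F0 h : (forall c, 0 <= h c) -> forall i, (0 <= F h i)%E.
  by move=> h0 i; rewrite /F; case: pickle_inv => //= c; rewrite lee_fin.
have E h : (forall c, 0 <= h c) ->
    (\esum_(c in [set: C]) (h c)%:E = \int[counting]_i F h i)%E.
  move=> h0; rewrite esum_countType// ?ge0_integral_count//.
  exact: F0.
rewrite E// (_ : (fun n => _) = fun n => \int[counting]_i F (a n) i)%E; last first.
  by apply/funext => n; apply: E => c; case/andP: (ag n c).
apply: (@dominated_cvg _ _ _ _ _ _ _ _ (F g)) => //.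
- move=> i _; rewrite /F; case: pickle_inv => [c|]/=; last exact: cvg_cst.
  by apply: cvg_EFin; [exact: nearW|exact: ab].
- by move=> i _; rewrite /F; case: pickle_inv.
- apply/integrableP; split => //.
  rewrite (_ : (fun _ => _) = F g) -?E//.
  by apply/funext => i; rewrite gee0_abs//; exact: F0.
- move=> n i _; rewrite /F; case: pickle_inv => [c|]/=; last by rewrite normr0.
  by case/andP: (ag n c) => a0 ?; rewrite lee_fin ger0_norm.
Qed.

Lemma measure_esum d (T : measurableType d) (m : {measure set T -> \bar R})
    (C : countType) (E : set T) (F : C -> set T) :
  measurable E -> (forall c, measurable (F c)) -> trivIset setT F ->
  E `<=` \bigcup_c F c ->
  m E = (\esum_(c in [set: C]) m (E `&` F c))%E.
Proof.
move=> mE mF tF EF; rewrite esum_countType//.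
(* Integers that encode no index are given the empty set. *)
pose G i := oapp (fun c => E `&` F c) set0 (@pickle_inv C i).
have EG : E = \bigcup_i G i.
  apply/seteqP; split => [w Ew|w [i _]].
    by have [c _ Fc] := EF _ Ew; exists (choice.pickle c) => //; rewrite /G pickleK_inv.
  by rewrite /G; case: pickle_inv => //= c [].
have mG i : measurable (G i).
  by rewrite /G; case: pickle_inv => [c|]//=; exact: measurableI.
rewrite [in LHS]EG measure_bigcup//; last first.
  move=> i j _ _ [w [Gi Gj]]; move: Gi Gj; rewrite /G.
  have := @pickle_invK C i; have := @pickle_invK C j.
  case: (@pickle_inv C i) => //= c; case: (@pickle_inv C j) => //= c' <- <-.
  by move=> [_ Fc] [_ Fc']; congr choice.pickle; apply: tF => //; exists w.
rewrite (eq_eseriesl (Q := xpredT)); last by move=> i; rewrite in_setT.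
by apply: eq_eseriesr => i _; rewrite /G; case: (@pickle_inv C i) => //=.
Qed.

(** Infinite distributivity: one factor is split off at a time, a function on
    [n.+1] points being a value at [ord0] and a function on the other points. *)
Lemma esum_prod_ord (C : choiceType) n (a : 'I_n -> C -> R) (s : 'I_n -> R) :
  (forall k c, 0 <= a k c) ->
  (forall k, \esum_(c in [set: C]) (a k c)%:E = (s k)%:E)%E ->
  (\esum_(h in [set: {ffun 'I_n -> C}]) (\prod_k a k (h k))%:E
   = (\prod_k s k)%:E)%E.
Proof.
elim: n a s => [|n IHn] a s a0 sE.
  rewrite big_ord0 (_ : [set: _] = [set [ffun k : 'I_0 => match k with
    Ordinal _ i => match notF i with end end]]).
    by rewrite esum_set1 ?big_ord0// lee_fin.
  by apply/seteqP; split=> // h _ /=; apply/ffunP => -[].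
have s0 k : 0 <= s k.
  by rewrite -lee_fin -sE; apply: esum_ge0 => c _; rewrite lee_fin.
pose cons (ch : C * {ffun 'I_n -> C}) : {ffun 'I_n.+1 -> C} :=
  [ffun k => oapp ch.2 ch.1 (unlift ord0 k)].
rewrite (@reindex_esum _ _ _ ([set: C] `*`` fun=> [set: {ffun 'I_n -> C}])
  setT cons); last first.
  split => //.
  - move=> [c h] [c' h'] _ _ /= /ffunP e; congr pair.
      by have := e ord0; rewrite !ffunE unlift_none.
    by apply/ffunP => k; have := e (lift ord0 k); rewrite !ffunE liftK.
  - move=> h _; exists (h ord0, [ffun k => h (lift ord0 k)]) => //.
    apply/ffunP => k; rewrite ffunE.
    by case: unliftP => [j ->|->]//=; rewrite ffunE.
rewrite -(@esum_esum _ _ _ _ _ (fun c h => (\prod_k a k (cons (c, h) k))%:E)%E);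
  last by move=> *; rewrite lee_fin prodr_ge0.
transitivity (\esum_(c in [set: C])
  (a ord0 c * \prod_(k < n) s (lift ord0 k))%:E)%E.
  apply: eq_esum => c _; rewrite EFinM -(IHn (fun k => a (lift ord0 k)))//.
  rewrite -esumZl//; last by move=> *; rewrite lee_fin prodr_ge0.
  apply: eq_esum => h _; rewrite -EFinM big_ord_recl ffunE unlift_none/=.
  by congr (_ * _)%:E; apply: eq_bigr => k _; rewrite ffunE liftK.
under eq_esum do rewrite mulrC EFinM.
rewrite esumZl//; [|exact: prodr_ge0|by move=> c; rewrite lee_fin].
by rewrite sE -EFinM mulrC big_ord_recl.
Qed.

(** This is what expresses that the particles of one generation reproduce
    independently. *)
Lemma esum_prod (I : finType) (C : choiceType) (a : I -> C -> R) (s : I -> R) :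
  (forall k c, 0 <= a k c) ->
  (forall k, \esum_(c in [set: C]) (a k c)%:E = (s k)%:E)%E ->
  (\esum_(h in [set: {ffun I -> C}]) (\prod_k a k (h k))%:E
   = (\prod_k s k)%:E)%E.
Proof.
move=> a0 sE.
have re (F : I -> R) : \prod_k F k = \prod_(i < #|I|) F (enum_val i).
  by rewrite (reindex (@enum_val I predT))//; apply: onW_bij; exact: enum_val_bij.
rewrite re -(esum_prod_ord (a := fun i => a (enum_val i)))//.
pose e (h : {ffun 'I_#|I| -> C}) : {ffun I -> C} := [ffun k => h (enum_rank k)].
rewrite (@reindex_esum _ _ _ setT setT e).
  apply: eq_esum => h _; rewrite re; congr EFin.
  by apply: eq_bigr => i _; rewrite ffunE enum_valK.
split=> // [h h' _ _ /ffunP eh|h _].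
  by apply/ffunP => i; have := eh (enum_val i); rewrite !ffunE enum_valK.
exists [ffun i => h (enum_val i)] => //.
by apply/ffunP => k; rewrite !ffunE enum_rankK.
Qed.

(** * Probability *)

Lemma esum_probability d (T : measurableType d)
    (P : probability T R) (C : countType) (E : set T) (e : T -> C) :
  (forall c, measurable [set w | e w = c]) -> measurable E ->
  (P E = \esum_(c in [set: C]) P (E `&` [set w | e w = c]))%E.
Proof.
move=> me mE; apply: measure_esum => //.
- by move=> i j _ _ [w [<- <-]].
- by move=> w _; exists (e w).
Qed.

Lemma probability_setI1 d (T : measurableType d) (P : probability T R) (E F : set T) :
  measurable E -> measurable F -> P E = 1%E -> (P (E `&` F) = P F)%E.
Proof.
move=> mE mF PE; rewrite [RHS](measureDI P mF mE) setIC.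
rewrite [X in (X + _)%E](_ : _ = 0%E) ?add0e//.
have PEC : P (~` E) = 0%E by rewrite probability_setC// PE subee.
have mEC := measurableC mE; have mFE := measurableD mF mE.
by apply: (@subset_measure0 _ _ _ P _ (~` E)).
Qed.

Lemma cvg_fine_mu d (T : measurableType d) (P : probability T R)
    (F : nat -> set T) : (forall n, measurable (F n)) ->
  {homo F : n m / (n <= m)%N >-> (n <= m)%O} ->
  fine (P (F n)) @[n --> \oo] --> fine (P (\bigcup_n F n)).
Proof.
move=> mF hF; have mU : measurable (\bigcup_n F n) by exact: bigcupT_measurable.
apply: fine_cvg; rewrite fineK ?fin_num_measure//.
exact: nondecreasing_cvg_mu.
Qed.

End Preliminaries.

(** * The generating function *)

Section GeneratingFunction.
Variables (R : realType) (X : countType).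
Implicit Types (mu : X -> probability (config X) R) (f g : config X).
Implicit Types (z w : X -> R).

Definition monom z f : R := \prod_(y <- supp f) z y ^+ f y.

Lemma config0 f y : y \notin supp f -> f y = 0%N.
Proof. exact: fsfun_dflt. Qed.

Lemma monomE z f (D : {fset X}) : (supp f `<=` D)%fset ->
  monom z f = \prod_(y <- D) z y ^+ f y.
Proof.
move=> fD; rewrite /monom; apply: big_fset_incl => // y _ /config0 ->.
by rewrite expr0.
Qed.

Lemma monom_ge0 z f : (forall x, 0 <= z x) -> 0 <= monom z f.
Proof. by move=> z0; apply: prodr_ge0 => y _; rewrite exprn_ge0. Qed.

Lemma monom_le z w f :
  (forall x, 0 <= z x <= w x) -> monom z f <= monom w f.
Proof.
move=> zw; apply: ler_prod => y _.
have /andP[z0 zwy] := zw y.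
by rewrite exprn_ge0//= lerXn2r// nnegrE// (le_trans z0).
Qed.

Lemma monom_cst1 f : monom (fun=> 1) f = 1.
Proof. by rewrite /monom big1// => y _; rewrite expr1n. Qed.

Lemma monom_le1 z f : (forall x, 0 <= z x <= 1) -> monom z f <= 1.
Proof. by move=> z1; rewrite -(monom_cst1 f); exact: monom_le. Qed.

Lemma monomM z w f : monom (fun x => z x * w x) f = monom z f * monom w f.
Proof.
by rewrite /monom -big_split; apply: eq_bigr => y _; rewrite exprMn.
Qed.

Lemma cvg_monom (u : nat -> X -> R) z f :
  (forall x, u n x @[n --> \oo] --> z x) ->
  monom (u n) f @[n --> \oo] --> monom z f.
Proof.
move=> uz; rewrite /monom.
elim: (enum_fset (supp f)) => [|y s IHs].
  by under eq_fun do rewrite big_nil; rewrite big_nil; exact: cvg_cst.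
under eq_fun do rewrite big_cons; rewrite big_cons.
apply: cvgM => //.
elim: (f y) => [|k IHk].
  by under eq_fun do rewrite expr0; rewrite expr0; exact: cvg_cst.
by under eq_fun do rewrite exprS; rewrite exprS; apply: cvgM.
Qed.

(** A common finite set of sites is needed since the supports of the
    summands may be strictly smaller than that of the total. *)
Lemma monom_sum z (I : finType) (h : I -> config X) g :
  (forall y, (\sum_k h k y)%N = g y) -> monom z g = \prod_k monom z (h k).
Proof.
move=> hg; pose D := (supp g `|` \bigcup_(k in I) supp (h k))%fset.
have hD k : (supp (h k) `<=` D)%fset.
  by apply: fsubset_trans (fsubsetUr _ _); exact: bigfcup_sup.
rewrite (monomE z (fsubsetUl _ _ : supp g `<=` D)%fset).
under [RHS]eq_bigr do rewrite (monomE z (hD _)).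
rewrite exchange_big/=; apply: eq_bigr => y _.
by rewrite -hg prodrXr.
Qed.

Lemma monom_particle z f : monom z f = \prod_(k : particle f) z (site k).
Proof.
rewrite /monom big_seq_fsetE/=.
rewrite (eq_bigr (fun y : supp f => \prod_(i < f (val y)) z (val y))); last first.
  by move=> y _; rewrite prodr_const card_ord.
by rewrite sig_big_dep.
Qed.

Lemma config_sum (I : finType) (h : I -> config X) :
  exists g : config X, forall y, (\sum_k h k y)%N = g y.
Proof.
pose D := (\bigcup_(k in I) supp (h k))%fset.
exists [fsfun y in D => (\sum_k h k y)%N | 0%N] => y.
rewrite /fun_of_config fsfunE; case: ifPn => // yD.
rewrite big1// => k _; apply: config0; apply: contra yD.
by apply: fsubsetP; exact: bigfcup_sup.
Qed.

Definition offspring mu x f : R := fine (mu x [set f]).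

Lemma offspringE mu x f : mu x [set f] = (offspring mu x f)%:E.
Proof. by rewrite /offspring fineK// fin_num_measure. Qed.

Lemma offspring_ge0 mu x f : 0 <= offspring mu x f.
Proof. by rewrite /offspring fine_ge0. Qed.

Lemma esum_offspring mu x : (\esum_(f in [set: config X]) (offspring mu x f)%:E = 1)%E.
Proof.
rewrite -(probability_setT (mu x)) (@esum_probability _ _ _ (mu x) (config X) _ id)//.
by apply: eq_esum => f _; rewrite -offspringE setTI.
Qed.

Definition genfun_term mu z x f : R := offspring mu x f * monom z f.

Lemma genfun_termE mu z x f :
  (mu x [set f] * (\prod_(y <- supp f) z y ^+ f y)%:E = (genfun_term mu z x f)%:E)%E.
Proof. by rewrite offspringE -EFinM. Qed.

Lemma genfun_term_ge0 mu z x f : (forall x, 0 <= z x) -> 0 <= genfun_term mu z x f.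
Proof. by move=> z0; apply: mulr_ge0; [exact: offspring_ge0|exact: monom_ge0]. Qed.

Lemma genfun_term_le mu z x f :
  (forall x, 0 <= z x <= 1) -> genfun_term mu z x f <= offspring mu x f.
Proof. by move=> z1; rewrite ler_piMr ?offspring_ge0 ?monom_le1. Qed.

Lemma genfunE mu z x : (forall x, 0 <= z x <= 1) ->
  ((genfun mu z x)%:E = \esum_(f in [set: config X]) (genfun_term mu z x f)%:E)%E.
Proof.
move=> z1; have z0 y : 0 <= z y by case/andP: (z1 y).
rewrite /genfun; under eq_esum do rewrite genfun_termE.
rewrite fineK// ge0_fin_numE; last first.
  by apply: esum_ge0 => f _; rewrite lee_fin genfun_term_ge0.
rewrite (@le_lt_trans _ _ 1%E)// ?ltry// -(esum_offspring mu x).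
by apply: le_esum => f _; rewrite lee_fin genfun_term_le.
Qed.

Lemma genfun_ge0 mu z x : (forall x, 0 <= z x <= 1) -> 0 <= genfun mu z x.
Proof.
move=> z1; rewrite -lee_fin genfunE//; apply: esum_ge0 => f _.
by rewrite lee_fin genfun_term_ge0// => y; case/andP: (z1 y).
Qed.

Lemma genfun_le mu z w x : (forall x, 0 <= z x <= 1) -> (forall x, 0 <= w x <= 1) ->
  (forall x, z x <= w x) -> genfun mu z x <= genfun mu w x.
Proof.
move=> z1 w1 zw; rewrite -lee_fin !genfunE//; apply: le_esum => f _.
rewrite lee_fin ler_wpM2l ?offspring_ge0// monom_le// => y.
by rewrite zw; case/andP: (z1 y) => ->.
Qed.

Lemma genfun_01 mu z x : (forall x, 0 <= z x <= 1) -> 0 <= genfun mu z x <= 1.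
Proof.
move=> z1; rewrite genfun_ge0//= -lee_fin genfunE// -(esum_offspring mu x).
by apply: le_esum => f _; rewrite lee_fin genfun_term_le.
Qed.

(** The offspring law is a finite measure, so it dominates the series. *)
Lemma cvg_genfun mu (u : nat -> X -> R) z x :
  (forall n x, 0 <= u n x <= 1) -> (forall x, 0 <= z x <= 1) ->
  (forall x, u n x @[n --> \oo] --> z x) ->
  genfun mu (u n) x @[n --> \oo] --> genfun mu z x.
Proof.
move=> u1 z1 uz.
have -> : genfun mu z x =
    fine (\esum_(f in [set: config X]) (genfun_term mu z x f)%:E)%E.
  by rewrite -genfunE.
have -> : (fun n => genfun mu (u n) x) =
    fine \o (fun n => \esum_(f in [set: config X]) (genfun_term mu (u n) x f)%:E)%E.
  by apply/funext => n /=; rewrite -genfunE.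
apply: fine_cvg; rewrite fineK; last by rewrite -genfunE.
apply: (@cvg_esum _ _ _ _ (offspring mu x)).
- by move=> f; apply: cvgM; [exact: cvg_cst|exact: cvg_monom].
- move=> n f; rewrite genfun_term_le// andbT genfun_term_ge0// => y.
  by case/andP: (u1 n y).
- by rewrite esum_offspring ltry.
Qed.

(** The branching property.  Summing over the total [g] and then over the
    assignments [h] with total [g] amounts to summing over all assignments, and
    [monom z g] factors over the particles; the sum of products is then the
    product of the one-particle sums, which are the values of [genfun]. *)
Lemma transition_monom mu z f : (forall x, 0 <= z x <= 1) ->
  (\esum_(g in [set: config X]) (brw_transition mu f g * (monom z g)%:E)
   = (monom (genfun mu z) f)%:E)%E.
Proof.
move=> z1; have z0 y : 0 <= z y by case/andP: (z1 y).
pose H g := [set h : {ffun particle f -> config X} |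
              forall y, (\sum_(k : particle f) h k y)%N = g y].
pose F (h : {ffun particle f -> config X}) :=
  (\prod_(k : particle f) genfun_term mu z (site k) (h k))%:E.
have F0 h : (0 <= F h)%E.
  by rewrite lee_fin; apply: prodr_ge0 => k _; exact: genfun_term_ge0.
transitivity (\esum_(g in [set: config X]) \esum_(h in H g) F h)%E.
  apply: eq_esum => g _; rewrite muleC -esumZl ?monom_ge0//; last first.
    by move=> h; apply: prode_ge0 => k _.
  apply: eq_esum => h hg; rewrite (monom_sum z hg).
  under [X in (_ * X)%E]eq_bigr do rewrite offspringE.
  by rewrite prodEFin -EFinM mulrC -big_split.
rewrite esum_esum// -(@reindex_esum _ _ _ _ setT snd F); last first.
  split=> //; last first.
    by move=> h _; have [g hg] := config_sum h; exists (g, h).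
  move=> [g h] [g' h']; rewrite !inE /= => -[_ hg] [_ hg'] hh'; congr pair => //.
  by apply/fsfunP => y; rewrite -[LHS]hg -[RHS]hg' hh'.
rewrite monom_particle.
apply: (esum_prod (a := fun k => genfun_term mu z (site k))) => [k h|k].
  exact: genfun_term_ge0.
by rewrite -genfunE.
Qed.

End GeneratingFunction.

(** * Avoiding a sequence of sets up to a finite time *)

Section Avoidance.
Variables (R : realType) (X : countType).
Implicit Types (mu nu : X -> probability (config X) R) (f g : config X).
Implicit Types (A B : set X) (C : nat -> set X) (z : X -> R).

(** The probability, starting from one particle at [x], that no particle is in
    [C k] at time [k], for every [k <= N]; see [avoid_iterE]. *)
Fixpoint avoid_iter mu C N (x : X) : R :=
  \1_(~` C 0%N) x *
  if N is N'.+1 then genfun mu (avoid_iter mu (fun k => C k.+1) N') x else 1.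

Lemma avoid_iter_01 mu C N x : 0 <= avoid_iter mu C N x <= 1.
Proof.
have h (b : bool) (t : R) : 0 <= t <= 1 -> 0 <= b%:R * t <= 1.
  by case: b => //; rewrite ?mul1r// mul0r lexx ler01.
elim: N C x => [|N IHN] C x /=; rewrite indicE; apply: h.
  by rewrite ler01 lexx.
by apply: genfun_01 => y; exact: IHN.
Qed.

Lemma eq_genfun mu nu z x :
  (forall F, mu x F = nu x F) -> genfun mu z x = genfun nu z x.
Proof. by move=> e; rewrite /genfun; under eq_esum do rewrite e. Qed.

(** At a site of [A] the indicator factor kills the generating function. *)
Lemma eq_avoid_iter mu nu A C N x :
  (forall y, ~ A y -> forall F, mu y F = nu y F) -> (forall k, A `<=` C k) ->
  avoid_iter mu C N x = avoid_iter nu C N x.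
Proof.
move=> e; elim: N C x => [//|N IHN] C x AC /=.
have [Ax|nAx] := pselect (A x).
  by rewrite indicE memNset ?mul0r//=; apply; exact: AC.
rewrite (eq_genfun _ (e _ nAx)); congr (_ * genfun nu _ x).
by apply/funext => y; apply: IHN => k; exact: AC.
Qed.

Lemma monom_indic A f :
  monom (\1_(~` A) : X -> R) f = `[< forall y, A y -> f y = 0%N >]%:R.
Proof.
case: asboolP => [h|/existsNP[y /not_implyP[Ay fy]]].
  rewrite /monom big1// => y _; rewrite indicE.
  have [Ay|nAy] := pselect (A y); first by rewrite h// expr0.
  by rewrite mem_set// expr1n.
have yf : y \in supp f by apply: contra_notT fy; exact: config0.
rewrite /monom (big_fsetD1 y)//= indicE memNset; last exact.
by rewrite expr0n; move: fy => /eqP/negbTE ->; rewrite mul0r.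
Qed.

Section Process.
Context d (T : measurableType d).
Implicit Types (P : X -> probability T R) (eta : nat -> T -> config X).

Definition avoids eta C : set T :=
  [set w | forall k y, C k y -> eta k w y = 0%N].

Lemma measurable_state mu P eta n (Q : config X -> Prop) :
  is_brw mu P eta -> measurable [set w | Q (eta n w)].
Proof.
move=> brw; rewrite -[X in measurable X]setTI.
exact: (brw_measurable brw n measurableT (Y := [set f | Q f])).
Qed.

Lemma measurable_path mu P eta (Q : nat -> config X -> Prop) :
  is_brw mu P eta -> measurable [set w | forall k, Q k (eta k w)].
Proof.
move=> brw; rewrite (_ : mkset _ = \bigcap_k [set w | Q k (eta k w)]).
  by apply: bigcapT_measurable => k; exact: (measurable_state _ (Q k) brw).
by apply/seteqP; split=> [w h k _|w h k]; [exact: h|exact: (h k I)].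
Qed.

(** The Markov property is only available for cylinders fixing the whole past,
    so the induction on [N] carries an arbitrary past [s]: the state at time
    [n.+1] is summed over and appended to it. *)
Lemma path_avoid mu P eta x n (s : nat -> config X) C N :
  is_brw mu P eta ->
  P x ([set w | forall k, (k <= n)%N -> eta k w = s k] `&`
       [set w | forall k, (k <= N)%N -> forall y, C k y -> eta (n + k)%N w y = 0%N])
  = (P x [set w | forall k, (k <= n)%N -> eta k w = s k]
     * (monom (avoid_iter mu C N) (s n))%:E)%E.
Proof.
move=> brw.
have mpath n' s' : measurable [set w | forall k, (k <= n')%N -> eta k w = s' k].
  exact: (measurable_path (fun k f => (k <= n')%N -> f = s' k) brw).
elim: N n s C => [|N IHN] n s C.
  rewrite (_ : avoid_iter mu C 0 = \1_(~` C 0%N)); last first.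
    by apply/funext => y /=; rewrite mulr1.
  rewrite monom_indic; case: asboolP => [h|h].
    rewrite mule1; congr (P x _); apply/seteqP; split => [w []//|w hw].
    by split=> // k; rewrite leqn0 => /eqP -> y Cy; rewrite addn0 hw// h.
  rewrite mule0 -(measure0 (P x)); congr (P x _).
  apply/seteqP; split => // w [hw hC]; apply: h => y Cy.
  by rewrite -hw// -[n]addn0; exact: hC.
pose C' k := C k.+1.
pose s' g k := if k == n.+1 then g else s k.
have s'n g : s' g n = s n by rewrite /s' ltn_eqF.
have s'n1 g : s' g n.+1 = g by rewrite /s' eqxx.
have s'k g k : (k <= n)%N -> s' g k = s k by move=> kn; rewrite /s' ltn_eqF.
rewrite (_ : avoid_iter mu C N.+1 =
  fun y => \1_(~` C 0%N) y * genfun mu (avoid_iter mu C' N) y)//.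
rewrite monomM monom_indic; case: asboolP => [h|h]; last first.
  rewrite mul0r mule0 -(measure0 (P x)); congr (P x _).
  apply/seteqP; split => // w [hw hC]; apply: h => y Cy.
  by rewrite -hw// -[n]addn0; exact: hC.
rewrite mul1r -transition_monom; last by move=> y; exact: avoid_iter_01.
have Pfin : P x [set w | forall k, (k <= n)%N -> eta k w = s k] \is a fin_num.
  exact: fin_num_measure.
rewrite -(fineK Pfin) -esumZl; last 2 first.
- exact/fine_ge0.
- move=> g; apply: mule_ge0; last first.
    by rewrite lee_fin monom_ge0// => y; case/andP: (avoid_iter_01 mu C' N y).
  by apply: esum_ge0 => hh _; apply: prode_ge0.
rewrite fineK// (@esum_probability _ _ _ _ _ _ (eta n.+1)); last 2 first.
- by move=> g; exact: (measurable_state _ (fun f => f = g) brw).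
- apply: measurableI => //.
  rewrite (_ : mkset _ = [set w | forall k, (n <= k)%N -> (k <= n + N.+1)%N ->
      forall y, C (k - n)%N y -> eta k w y = 0%N]).
    exact: (measurable_path (fun k f => (n <= k)%N -> (k <= n + N.+1)%N ->
      forall y, C (k - n)%N y -> f y = 0%N) brw).
  apply/seteqP; split => [w h' k nk kN y Cy|w h' k kN y Cy].
    by rewrite -(subnKC nk); apply: h' => //; rewrite leq_subLR.
  by apply: h'; rewrite ?leq_addr ?leq_add2l// addKn.
apply: eq_esum => g _.
have := IHN n.+1 (s' g) C'; rewrite s'n1 => IH.
rewrite muleA.
have := brw_markov brw x n (s' g); rewrite s'n s'n1.
rewrite (_ : [set w | forall k, (k <= n)%N -> eta k w = s' g k] =
  [set w | forall k, (k <= n)%N -> eta k w = s k]); last first.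
  by apply/seteqP; split => w hw k kn; rewrite hw ?s'k.
move=> <-; rewrite -IH; congr (P x _).
apply/seteqP; split => w.
  move=> [[hw hC] /= hg]; split => /= k.
    rewrite leq_eqVlt => /predU1P[->|]; first by rewrite s'n1.
    by rewrite ltnS => kn; rewrite s'k// hw.
  by move=> kN y Cy; rewrite addSnnS; exact: hC.
move=> [/= hw hC]; split; last by rewrite /= hw.
split => k /= kn; first by rewrite hw ?s'k// leqW.
case: k kn => [_|k kN] y Cy; last by rewrite -addSnnS; exact: hC.
by rewrite addn0 hw ?leqnSn// s'k// h.
Qed.

Lemma avoid_iterE mu P eta C N x : is_brw mu P eta ->
  P x [set w | forall k, (k <= N)%N -> forall y, C k y -> eta k w y = 0%N]
  = (avoid_iter mu C N x)%:E.
Proof.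
move=> brw.
have := path_avoid x 0 (fun=> one_particle x) C N brw.
rewrite (_ : [set w | forall k, (k <= 0)%N -> _] =
    [set w | eta 0%N w = one_particle x]); last first.
  apply/seteqP; split => [w|w h k]; first exact.
  by rewrite leqn0 => /eqP ->.
rewrite (brw_start brw) mul1e.
have -> : monom (avoid_iter mu C N) (one_particle x) = avoid_iter mu C N x.
  rewrite (@monomE _ _ _ _ [fset x]%fset).
    by rewrite big_seq_fset1 /fun_of_config fsfunE inE eqxx expr1.
  apply/fsubsetP => y; rewrite mem_finsupp /one_particle fsfunE.
  by case: ifP.
move=> <-; apply/esym/probability_setI1 => //.
- exact: (measurable_state 0 (fun f => f = one_particle x) brw).
- exact: (measurable_path
    (fun k f => (k <= N)%N -> forall y, C k y -> f y = 0%N) brw).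
- exact: (brw_start brw).
Qed.

End Process.
End Avoidance.

(** * Avoidance for ever and extinction *)

Section Extinction.
Variables (R : realType) (X : countType).
Implicit Types (mu nu : X -> probability (config X) R).
Implicit Types (A B : set X) (C : nat -> set X) (z : X -> R).
Context d (T : measurableType d).
Implicit Types (P : X -> probability T R) (eta : nat -> T -> config X).

Definition avoid_prob P eta C x : R := fine (P x (avoids eta C)).

Lemma measurable_avoids mu P eta C : is_brw mu P eta -> measurable (avoids eta C).
Proof. exact: (measurable_path (fun k f => forall y, C k y -> f y = 0%N)). Qed.

Lemma cvg_avoid_iter mu P eta C x : is_brw mu P eta ->
  avoid_iter mu C N x @[N --> \oo] --> avoid_prob P eta C x.
Proof.
move=> brw.
pose F N := [set w | forall k, (k <= N)%N -> forall y, C k y -> eta k w y = 0%N].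
have mF N : measurable (F N).
  exact: (measurable_path
    (fun k f => (k <= N)%N -> forall y, C k y -> f y = 0%N) brw).
have FE : \bigcap_N F N = avoids eta C.
  by apply/seteqP; split=> [w h k y|w h N _ k _ y]; [exact: (h k I k)|exact: h].
have mC := measurable_avoids C brw.
have h : P x (F N) @[N --> \oo] --> P x (avoids eta C).
  rewrite -FE; apply: nonincreasing_cvg_mu => //.
  - by rewrite -ge0_fin_numE// fin_num_measure.
  - by rewrite FE.
  - move=> N N' NN'; apply/subsetPset => w h k kN.
    by apply: h; exact: leq_trans NN'.
rewrite (_ : (fun N => _) = fine \o (fun N => P x (F N))); last first.
  by apply/funext => N; rewrite /= (avoid_iterE _ _ _ brw).
by apply: fine_cvg; rewrite fineK ?fin_num_measure.
Qed.

Lemma avoid_prob_01 mu P eta C x : is_brw mu P eta ->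
  0 <= avoid_prob P eta C x <= 1.
Proof.
move=> brw; have mC := measurable_avoids C brw.
rewrite /avoid_prob fine_ge0//= -lee_fin fineK ?fin_num_measure//.
exact: probability_le1.
Qed.

(** Both sides are limits of the finite-time recursion, whose indicator factor
    is 1 when [C 0] is empty. *)
Lemma avoid_probS mu P eta C x : is_brw mu P eta -> C 0%N = set0 ->
  avoid_prob P eta C x = genfun mu (avoid_prob P eta (fun k => C k.+1)) x.
Proof.
move=> brw C0; have h := cvg_avoid_iter (C := C) (x := x) brw.
have {h} : avoid_iter mu C N.+1 x @[N --> \oo] --> avoid_prob P eta C x.
  by move: h; rewrite -cvg_shiftS.
have -> : (fun N => avoid_iter mu C N.+1 x) =
    (fun N => genfun mu (avoid_iter mu (fun k => C k.+1) N) x).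
  by apply/funext => N /=; rewrite C0 setC0 indicT mul1r.
move=> h; apply: (cvg_unique _ h); first exact: Rhausdorff.
apply: cvg_genfun => [N y|y|y].
- exact: avoid_iter_01.
- exact: avoid_prob_01 brw.
- exact: cvg_avoid_iter.
Qed.

(** Avoiding this sequence means that [A] is empty from time [n] on. *)
Definition from n A : nat -> set X := fun k => [set y | (n <= k)%N /\ A y].

Lemma q_E P eta n A : q_ P eta n A = avoid_prob P eta (from n A).
Proof.
apply/funext => x; congr (fine (P x _)).
by apply/seteqP; split => w h k; [move=> y [nk Ay]|move=> nk y Ay]; apply: h.
Qed.

Lemma q_S mu P eta n A x : is_brw mu P eta ->
  q_ P eta n.+1 A x = genfun mu (q_ P eta n A) x.
Proof.
move=> brw; rewrite !q_E (avoid_probS _ brw)//.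
by apply/seteqP; split => // y [].
Qed.

Lemma q_01 mu P eta n A x : is_brw mu P eta -> 0 <= q_ P eta n A x <= 1.
Proof. by rewrite q_E; exact: avoid_prob_01. Qed.

Definition extinct eta A : set T := \bigcup_n avoids eta (from n A).

Lemma measurable_extinct mu P eta A : is_brw mu P eta -> measurable (extinct eta A).
Proof. by move=> brw; apply: bigcupT_measurable => n; exact: measurable_avoids brw. Qed.

Lemma avoids_from_mono eta A : {homo (fun n => avoids eta (from n A)) :
  n m / (n <= m)%N >-> (n <= m)%O}.
Proof.
move=> n m nm; apply/subsetPset => w h k y [mk Ay]; apply: h; split => //.
exact: leq_trans mk.
Qed.

(** The number of particles in [A] is a natural number: its upper limit is at
    least 1 unless it vanishes from some time on. *)
Lemma survivesE eta A :
  [set w | (0 < limn_esup (fun n => \esum_(y in A) ((eta n w y)%:R : R)%:E))%E]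
  = ~` extinct eta A.
Proof.
apply/seteqP; split=> w /=.
  move=> h [n _ hn]; move: h; apply/negP; rewrite -leNgt.
  rewrite (cvg_limn_einf_sup (l := 0%E) _)//.
  apply: cvg_near_cst; exists n => //= k /= nk.
  by rewrite esum1// => y Ay; rewrite hn.
move=> h; set u := fun n => _.
rewrite (@lt_le_trans _ _ 1%E)// limn_esup_lim; apply: lime_ge.
  exact: is_cvg_esups.
apply: nearW => n; rewrite /esups/=.
have [k [nk [y [Ay yk]]]] : exists k, (n <= k)%N /\ exists y, A y /\ eta k w y <> 0%N.
  apply: contra_notP h => h; exists n => // k y [nk Ay].
  by apply: contra_notP h => h; exists k; split => //; exists y.
apply: (@le_trans _ _ (u k)); last first.
  by apply: ereal_sup_ubound; exists k.
rewrite /u (esumID [set y])//.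
rewrite (_ : A `&` [set y] = [set y]); last first.
  by apply/seteqP; split => [? []//|? ->].
rewrite esum_set1 ?lee_fin// (@le_trans _ _ ((eta k w y)%:R : R)%:E)//.
  by rewrite lee_fin ler1n lt0n; apply/eqP.
by rewrite leeDl// esum_ge0// => *; rewrite lee_fin.
Qed.

Lemma qE mu P eta A x : is_brw mu P eta -> q P eta A x = fine (P x (extinct eta A)).
Proof.
move=> brw; have mE := measurable_extinct A brw.
rewrite /q survivesE probability_setC// fineB ?fin_num_measure//=.
by rewrite opprB addrCA subrr addr0.
Qed.

Lemma cvg_q_ mu P eta A x : is_brw mu P eta ->
  q_ P eta n A x @[n --> \oo] --> q P eta A x.
Proof.
move=> brw; rewrite (qE _ _ brw).
have -> : (fun n => q_ P eta n A x) = (fun n => fine (P x (avoids eta (from n A)))).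
  by apply/funext => n; rewrite q_E.
apply: cvg_fine_mu; last exact: avoids_from_mono.
by move=> n; exact: measurable_avoids brw.
Qed.

(** Pass to the limit in [q_S]. *)
Lemma q_fixed mu P eta A : is_brw mu P eta -> fixed_point mu (q P eta A).
Proof.
move=> brw.
have q1 x : 0 <= q P eta A x <= 1.
  have mE := measurable_extinct A brw.
  rewrite (qE _ _ brw) fine_ge0//= -lee_fin fineK ?fin_num_measure//.
  exact: probability_le1.
split => // x.
have h : q_ P eta n.+1 A x @[n --> \oo] --> q P eta A x.
  by have := cvg_q_ (A := A) (x := x) brw; rewrite -cvg_shiftS.
move: h; rewrite (_ : (fun n => _) = fun n => genfun mu (q_ P eta n A) x); last first.
  by apply/funext => n; exact: q_S brw.
move=> h; apply: (cvg_unique _ _ h); first exact: Rhausdorff.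
apply: cvg_genfun => // [n y|y]; first exact: q_01 brw.
exact: cvg_q_ brw.
Qed.

Lemma q_0_le_q mu P eta A x : is_brw mu P eta -> q_ P eta 0 A x <= q P eta A x.
Proof.
move=> brw; rewrite q_E (qE _ _ brw).
have mE := measurable_extinct A brw; have mA := measurable_avoids (from 0 A) brw.
rewrite fine_le ?fin_num_measure//; apply: le_measure; rewrite ?inE//.
by move=> w h; exists 0%N.
Qed.

Lemma q_antimono mu P eta A B x : is_brw mu P eta -> A `<=` B ->
  q P eta B x <= q P eta A x.
Proof.
move=> brw AB; rewrite !(qE _ _ brw).
have mA := measurable_extinct A brw; have mB := measurable_extinct B brw.
rewrite fine_le ?fin_num_measure//; apply: le_measure; rewrite ?inE//.
by move=> w [n _ h]; exists n => // k y [nk Ay]; apply: h; split => //; exact: AB.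
Qed.

(** From [q_ 0 <= z] one gets [q_ n <= z] by applying the monotone map [genfun],
    which fixes [z]; then [n] tends to infinity. *)
Lemma q_le_fixed mu P eta A z : is_brw mu P eta -> fixed_point mu z ->
  (forall x, q P eta A x <= z x) <-> (forall x, q_ P eta 0 A x <= z x).
Proof.
move=> brw [z1 zfix]; split => h x; first exact: le_trans (q_0_le_q A x brw) (h x).
have qn n : forall y, q_ P eta n A y <= z y.
  elim: n => // n IHn y; rewrite (q_S _ _ _ brw) -zfix.
  by apply: genfun_le => // ?; exact: q_01 brw.
have hc := cvg_q_ (A := A) (x := x) brw; rewrite -(cvg_lim (@Rhausdorff R) hc).
apply: limr_le; first by apply/cvg_ex; exists (q P eta A x).
by apply: nearW => n; exact: qn.
Qed.

Lemma q_eqP mu P eta A B : is_brw mu P eta -> A `<=` B ->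
  (forall x, q P eta A x <= q P eta B x) <-> (forall x, q P eta A x = q P eta B x).
Proof.
move=> brw AB; split => h x; last by rewrite h.
by apply/eqP; rewrite eq_le h (q_antimono _ brw AB).
Qed.

(** Avoiding this sequence, when [A] is contained in [B], means never visiting
    [A] and not visiting [B] from time [n] on. *)
Definition switch A B n : nat -> set X := fun k => if (n <= k)%N then B else A.

(** The limit is the probability of never visiting [A] and visiting [B] finitely
    often.  It equals [q_ 0 A] exactly when, almost surely, a process that never
    visits [A] visits [B] finitely often; the right-hand side thus involves
    the process only until it hits [A]. *)
Lemma q_eq_switch mu P eta A B : is_brw mu P eta -> A `<=` B ->
  (forall x, q P eta A x = q P eta B x) <->
  (forall x, avoid_prob P eta (switch A B n) x @[n --> \oo] --> q_ P eta 0 A x).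
Proof.
move=> brw AB.
have mA := measurable_extinct A brw; have mB := measurable_extinct B brw.
have m0 := measurable_avoids (from 0 A) brw.
have switchE n : avoids eta (switch A B n) =
    avoids eta (from 0 A) `&` avoids eta (from n B).
  apply/seteqP; split => [w h|w [hA hB] k y].
    split=> k y [nk Ay]; apply: h; rewrite /switch; last by rewrite nk.
    by case: ifP => _ //; exact: AB.
  by rewrite /switch; case: ifP => nk Cy; [exact: hB|exact: hA].
have sw x : avoid_prob P eta (switch A B n) x @[n --> \oo] -->
    fine (P x (avoids eta (from 0 A) `&` extinct eta B)).
  rewrite /extinct setI_bigcupr.
  have -> : (fun n => avoid_prob P eta (switch A B n) x) =
      (fun n => fine (P x (avoids eta (from 0 A) `&` avoids eta (from n B)))).
    by apply/funext => n; rewrite /avoid_prob switchE.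
  apply: cvg_fine_mu => [n|n m nm].
    by apply: measurableI => //; exact: measurable_avoids brw.
  apply/subsetPset; apply: setIS; apply/subsetPset.
  exact: avoids_from_mono.
have BA : extinct eta B `<=` extinct eta A.
  by move=> w [n _ h]; exists n => // k y [nk Ay]; apply: h; split => //; exact: AB.
split => h; last first.
  apply/(q_eqP brw AB)/(q_le_fixed _ brw (q_fixed B brw)) => x.
  rewrite -(cvg_unique (@Rhausdorff R) (sw x) (h x)) (qE _ _ brw).
  rewrite fine_le ?fin_num_measure//; first exact: measurableI.
  by apply: le_measure; rewrite ?inE//; exact: measurableI.
move=> x; suff -> : q_ P eta 0 A x =
    fine (P x (avoids eta (from 0 A) `&` extinct eta B)) by exact: sw.
rewrite q_E; congr fine; rewrite (measureDI (P x) m0 mB).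
rewrite [X in (X + _)%E](_ : _ = 0%E) ?add0e//.
(* The extinction event of B is contained in that of A, with equal mass. *)
have null : P x (extinct eta A `\` extinct eta B) = 0%E.
  have PAB : P x (extinct eta A) = P x (extinct eta B).
    by rewrite -[LHS]fineK ?fin_num_measure// -[RHS]fineK ?fin_num_measure//
       -!(qE _ _ brw) h.
  transitivity (P x (extinct eta A) - P x (extinct eta A `&` extinct eta B))%E.
    by apply: measureD => //; rewrite -ge0_fin_numE// fin_num_measure.
  by rewrite setIidr// PAB subee// fin_num_measure.
have mD := measurableD mA mB; have mD0 := measurableD m0 mB.
apply: (@subset_measure0 _ _ _ (P x) _ (extinct eta A `\` extinct eta B)) => //.
by move=> w [hA hB]; split => //; exists 0%N.
Qed.

End Extinction.

Lemma eq_avoid_prob (R : realType) (X : countType)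
    (mu nu : X -> probability (config X) R)
    d1 (T1 : measurableType d1) d2 (T2 : measurableType d2)
    (P1 : X -> probability T1 R) (eta1 : nat -> T1 -> config X)
    (P2 : X -> probability T2 R) (eta2 : nat -> T2 -> config X)
    (A : set X) (C : nat -> set X) x :
  is_brw mu P1 eta1 -> is_brw nu P2 eta2 ->
  (forall y, ~ A y -> forall F, mu y F = nu y F) -> (forall k, A `<=` C k) ->
  avoid_prob P1 eta1 C x = avoid_prob P2 eta2 C x.
Proof.
move=> brw1 brw2 e AC; have := cvg_avoid_iter (C := C) (x := x) brw2.
have -> : (fun N => avoid_iter nu C N x) = (fun N => avoid_iter mu C N x).
  by apply/funext => N; rewrite (eq_avoid_iter _ _ e AC).
by move=> h; apply: (cvg_unique _ (cvg_avoid_iter brw1) h); exact: Rhausdorff.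
Qed.

Theorem theorem2p4 (R : realType) (X : countType) :
  (forall (mu : X -> probability (config X) R)
      (d : measure_display) (T : measurableType d)
      (P : X -> probability T R) (eta : nat -> T -> config X),
    is_brw mu P eta ->
    forall A : set X,
      (forall z : X -> R, fixed_point mu z ->
        ((forall x, q P eta A x <= z x) <->
         (forall x, q_ P eta 0 A x <= z x)))
      /\
      (forall B : set X, A `<=` B ->
        ((forall x, q P eta A x <= q P eta B x) <->
         (forall x, q P eta A x = q P eta B x)) /\
        ((forall x, q_ P eta 0 A x <= q P eta B x) <->
         (forall x, q P eta A x = q P eta B x))))
  /\
  (forall (mu nu : X -> probability (config X) R)
      (d1 : measure_display) (T1 : measurableType d1)
      (P1 : X -> probability T1 R) (eta1 : nat -> T1 -> config X)
      (d2 : measure_display) (T2 : measurableType d2)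
      (P2 : X -> probability T2 R) (eta2 : nat -> T2 -> config X),
    is_brw mu P1 eta1 -> is_brw nu P2 eta2 ->
    forall A : set X, A !=set0 ->
    (forall x, ~ A x -> forall F : set (config X), mu x F = nu x F) ->
      (forall x, q_ P1 eta1 0 A x = q_ P2 eta2 0 A x)
      /\
      (forall B : set X, A `<=` B ->
        ((forall x, q P1 eta1 A x = q P1 eta1 B x) <->
         (forall x, q P2 eta2 A x = q P2 eta2 B x)))).
Proof.
split=> [mu d T P eta brw A|].
  split=> [z zfix|B AB]; first exact: q_le_fixed brw zfix.
  split; first exact: q_eqP brw AB.
  rewrite -(q_eqP brw AB); apply: iff_sym.
  exact: q_le_fixed brw (q_fixed B brw).
move=> mu nu d1 T1 P1 eta1 d2 T2 P2 eta2 brw1 brw2 A _ e.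
have q0 x : q_ P1 eta1 0 A x = q_ P2 eta2 0 A x.
  by rewrite !q_E; apply: eq_avoid_prob brw1 brw2 e _ => k y Ay.
split => // B AB.
have sw n x : avoid_prob P1 eta1 (switch A B n) x = avoid_prob P2 eta2 (switch A B n) x.
  apply: eq_avoid_prob brw1 brw2 e _ => k y Ay.
  by rewrite /switch; case: ifP => // _; exact: AB.
rewrite (q_eq_switch brw1 AB) (q_eq_switch brw2 AB).
split => h x; [rewrite -q0|rewrite q0].
  by have := h x; under eq_fun do rewrite sw.
by have := h x; under eq_fun do rewrite -sw.
Qed.
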